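(* Let $N\ge 1$ and let $p_1,\dots,p_N$ be probability densities (data-generating distributions) on $\mathbb{R}^d$. Set $Z=\int \max_i p_i(x)\,\mathrm{d}x$ and $p_{\max}(x)=\frac{1}{Z}\max_i p_i(x)$. For a probability density $p_g$ on $\mathbb{R}^d$ (the generator's distribution) let $$D_i^*(x)=\frac{p_i(x)}{p_i(x)+p_g(x)}\quad(i=1,\dots,N),\qquad D^*_{\max}(x)=\max_i D^*_i(x),$$ and let $$\mathcal{L}_G(p_g)=\frac12\left\{\mathbb{E}_{x\sim p_{\max}}\left[(D^*_{\max}(x)-1)^2\right]+\mathbb{E}_{x\sim p_g}\left[(D^*_{\max}(x)-1)^2\right]\right\}.$$ Then the global minimum of $\mathcal{L}_G(p_g)$ over all probability densities $p_g$ is achieved if and only if $p_g=p_{\max}$ (almost everywhere).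
   Context: Here $D^*_{\max}$ depends on $p_g$ through the $D_i^*$, and $\mathcal{L}_G$ is regarded as a functional of $p_g$ alone, with $p_1,\dots,p_N$ fixed. $D_i^*$ is the optimal least-squares-GAN discriminator for real-data density $p_i$ and generator density $p_g$ (real label $1$, fake label $0$), and $\mathcal{L}_G$ is the least-squares generator objective (target label $1$) with data distribution $p_{\max}$ and discriminator $D^*_{\max}$. Densities are with respect to Lebesgue measure and are nonnegative, measurable, and identified when equal almost everywhere. The convention $0/0=0$ is used in the definition of $D_i^*$. *)

(* Defs.v *)
From HB Require Import structures.
From mathcomp Require Import all_boot all_order all_algebra.
From mathcomp Require Import all_classical all_reals all_analysis.
From mathcomp Require Import measurable_realfun.

Set Implicit Arguments.
Unset Strict Implicit.
Unset Printing Implicit Defensive.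
Import Order.TTheory GRing.Theory Num.Theory.

Local Open Scope classical_set_scope.
Local Open Scope ring_scope.

(** * Lebesgue measure on R^d

    R^d is the type of d-tuples of reals with its library sigma-algebra, generated
    by the coordinates, i.e. the Borel sigma-algebra ([measurableTypeR R] is [R]
    with its Borel sets).  The measure is the iterated product measure,
    transported along [(x, t) |-> x :: t]; [lebesgue_box] below computes it on
    boxes. *)

Notation euclid R d := (d.-tuple (measurableTypeR R)).

Definition consT (R : Type) (n : nat) (xt : R * n.-tuple R) : n.+1.-tuple R :=
  [tuple of xt.1 :: xt.2].

Lemma measurable_consT (R : realType) (n : nat) :
  measurable_fun [set: measurableTypeR R * euclid R n]
    (@consT (measurableTypeR R) n).
Proof. exact: (measurable_cons measurable_fst measurable_snd). Qed.

Section lebesgue_step.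
Context (R : realType) (n : nat).
Variable m : {sigma_finite_measure set (euclid R n) -> \bar R}.

Definition lebesgue_step : set (euclid R n.+1) -> \bar R :=
  pushforward (@lebesgue_measure R \x m)%E (@consT (measurableTypeR R) n).

Let lebesgue_step0 : lebesgue_step set0 = 0%E.
Proof. by rewrite /lebesgue_step /pushforward preimage_set0 measure0. Qed.

Let lebesgue_step_ge0 A : (0 <= lebesgue_step A)%E.
Proof. exact: (measure_ge0 (@lebesgue_measure R \x m)%E). Qed.

Let lebesgue_step_sigma_additive : semi_sigma_additive lebesgue_step.
Proof.
move=> F mF tF mUF; rewrite /lebesgue_step /pushforward preimage_bigcup.
apply: measure_semi_sigma_additive.
- by move=> k; rewrite -[X in measurable X]setTI; exact: measurable_consT.
- by apply/trivIsetP => /= i j _ _ ij; rewrite -preimage_setI;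
    move/trivIsetP: tF => -> //; rewrite preimage_set0.
- by rewrite -preimage_bigcup -[X in measurable X]setTI; exact: measurable_consT.
Qed.

HB.instance Definition _ := isMeasure.Build _ _ _ lebesgue_step
  lebesgue_step0 lebesgue_step_ge0 lebesgue_step_sigma_additive.

Let lebesgue_step_sigma_finite : sigma_finite setT lebesgue_step.
Proof.
have /sigma_finiteP[F [TF ndF Foo]] := sigma_finiteT (@lebesgue_measure R).
have /sigma_finiteP[G [TG ndG Goo]] := sigma_finiteT m.
pose hd_tl (t : euclid R n.+1) : measurableTypeR R * euclid R n :=
  (thead t, [tuple of behead t]).
have mhd_tl : measurable_fun setT hd_tl.
  apply: measurable_fun_pair; first exact: measurable_tnth.
  exact: measurable_behead.
have hd_tlK : hd_tl \o @consT (measurableTypeR R) n = id.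
  by apply/funext => -[x t]; congr (_, _); exact: val_inj.
exists (fun k => hd_tl @^-1` (F k `*` G k)).
  apply/esym; rewrite -subTset => t _.
  have [i _ Fi] : (\bigcup_k F k) (thead t) by rewrite -TF.
  have [j _ Gj] : (\bigcup_k G k) [tuple of behead t] by rewrite -TG.
  exists (maxn i j) => //; split.
    by have /subsetPset := ndF _ _ (leq_maxl i j); exact.
  by have /subsetPset := ndG _ _ (leq_maxr i j); exact.
move=> k; have [mF Foo_k] := Foo k; have [mG Goo_k] := Goo k; split.
  by rewrite -[X in measurable X]setTI; apply: mhd_tl => //; exact: measurableX.
rewrite /lebesgue_step /pushforward -comp_preimage hd_tlK preimage_id.
by rewrite product_measure1E// lte_mul_pinfty// ge0_fin_numE.
Qed.

HB.instance Definition _ := Measure_isSigmaFinite.Build _ _ _ lebesgue_step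
  lebesgue_step_sigma_finite.

End lebesgue_step.

Fixpoint lebesgue (R : realType) (d : nat) :
    {sigma_finite_measure set (euclid R d) -> \bar R} :=
  match d with
  | 0 => \d_[tuple]
  | n.+1 => lebesgue_step (lebesgue R n)
  end.

Lemma lebesgue_box (R : realType) (d : nat) (A : 'I_d -> set (measurableTypeR R)) :
  (forall i, measurable (A i)) ->
  lebesgue R d [set t | forall i, A i (tnth t i)] =
  (\prod_(i < d) @lebesgue_measure R (A i))%E.
Proof.
elim: d A => [|n IH] A mA /=.
  by rewrite big_ord0 diracE mem_set// => -[].
rewrite big_ord_recl -IH// -product_measure1E//; last first.
  rewrite (_ : [set _ | _] = \bigcap_(i in [set: 'I_n])
    ((fun t : euclid R n => tnth t i) @^-1` A (lift ord0 i))); last first.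
    by apply/seteqP; split => [t At i _|t At i]; exact: At.
  apply: fin_bigcap_measurable => // i _.
  by rewrite -[X in measurable X]setTI; exact: measurable_tnth.
rewrite /lebesgue_step /pushforward; congr (_ _).
apply/seteqP; split => -[x t] /=.
  move=> At; split=> [|i]; first exact: (At ord0).
  by have := At (lift ord0 i); rewrite tnthS.
move=> [Ax At] i; case: (unliftP ord0 i) => [j ->|->]; last exact: Ax.
by rewrite tnthS; exact: At.
Qed.

(** * Densities and the least-squares GAN objective *)

Definition is_density (R : realType) (d : nat) (p : euclid R d -> R) : Prop :=
  [/\ measurable_fun setT p, (forall x, 0 <= p x)
    & (\int[lebesgue R d]_x (p x)%:E = 1)%E].

(** [E_{x ~ p}[f]] for a density [p] and a nonnegative [f]. *)
Definition expectation_density (R : realType) (d : nat) (p f : euclid R d -> R) :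
  \bar R := (\int[lebesgue R d]_x (f x * p x)%:E)%E.

Section lsgan.
Context (R : realType) (d N : nat).
Implicit Types (p : 'I_N -> euclid R d -> R) (pg : euclid R d -> R).

(** Maxima over [i] are seeded with [0], which is harmless: they are only taken
    over nonempty families of nonnegative numbers. *)
Definition max_density p (x : euclid R d) : R := \big[Num.max/0]_(i < N) p i x.

Definition Zmax p : R := \int[lebesgue R d]_x max_density p x.

Definition pmax p (x : euclid R d) : R := (Zmax p)^-1 * max_density p x.

(** The convention [0 / 0 = 0] is that of division in MathComp fields. *)
Definition Dstar p pg (i : 'I_N) (x : euclid R d) : R :=
  p i x / (p i x + pg x).

Definition Dstar_max p pg (x : euclid R d) : R :=
  \big[Num.max/0]_(i < N) Dstar p pg i x.

Definition LG p pg : \bar R :=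
  ((2^-1)%:E *
    (expectation_density (pmax p) (fun x => (Dstar_max p pg x - 1) ^+ 2)%R
     + expectation_density pg (fun x => (Dstar_max p pg x - 1) ^+ 2)%R))%E.

End lsgan.

(** In particular [pmax p] is one of the densities over which [LG p] is minimized. *)
Lemma pmax_density (R : realType) (d N : nat) (p : 'I_N -> euclid R d -> R) :
  (0 < N)%N -> (forall i, is_density (p i)) -> is_density (pmax p).
Proof.
move=> N0 hp.
have mm : measurable_fun setT (max_density p).
  rewrite /max_density; elim: (index_enum 'I_N) => [|i s IH].
    under eq_fun do rewrite big_nil; exact: measurable_cst.
  under eq_fun do rewrite big_cons.
  by apply: measurable_realfun.measurable_maxr => //; case: (hp i).
have m0 x : 0 <= max_density p x by rewrite /max_density; exact: bigmax_ge_id.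
have le1 i x : p i x <= max_density p x by exact: le_bigmax.
have leS x : max_density p x <= \sum_(i < N) p i x.
  apply: bigmax_le; first by apply: sumr_ge0 => i _; case: (hp i).
  move=> i _; rewrite (bigD1 i)//= lerDl; apply: sumr_ge0 => j _; by case: (hp j).
pose I := (\int[lebesgue R d]_x (max_density p x)%:E)%E.
have I1 : (1 <= I)%E.
  have [mp p0 Ip] := hp (Ordinal N0); rewrite -Ip.
  apply: ge0_le_integral => //;
    first [exact/measurable_EFinP | by move=> x _; rewrite lee_fin ?p0 ?m0 ?le1].
have IN : (I <= (N%:R)%:E)%E.
  apply: (@le_trans _ _ (\int[lebesgue R d]_x (\sum_(i < N) (p i x)%:E))%E).
    apply: ge0_le_integral => //;
     first [exact/measurable_EFinP
     | by apply: emeasurable_sum => i; apply/measurable_EFinP; case: (hp i)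
     | by move=> x _; rewrite ?sumEFin lee_fin ?m0 ?leS//; apply: sumr_ge0 => i _; case: (hp i)].
  rewrite ge0_integral_sum//; do ?[by move=> i; apply/measurable_EFinP; case: (hp i)|by move=> i x _; rewrite lee_fin; case: (hp i)].
  - rewrite (eq_bigr (fun=> 1%E)); last by move=> i _; case: (hp i).
    by rewrite sumEFin sumr_const card_ord.
have Ifin : I \is a fin_num.
  by rewrite ge0_fin_numE ?(le_trans _ I1)//; exact: le_lt_trans IN (ltry _).
have IZ : I = (Zmax p)%:E by rewrite fineK.
have Z0 : 0 < Zmax p.
  by rewrite -lte_fin -IZ (lt_le_trans _ I1).
split.
- exact: measurable_funM.
- by move=> x; apply: mulr_ge0; [rewrite invr_ge0; exact: ltW | exact: m0].
- rewrite /pmax; under eq_integral do rewrite EFinM.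
  rewrite ge0_integralZl//; first by rewrite -/I IZ -EFinM mulVf ?gt_eqF.
  all: first [exact/measurable_EFinP | by move=> x _; rewrite lee_fin m0 | by rewrite lee_fin invr_ge0 ltW | idtac].
Qed.

(* Main.v *)
(** Write [P = pmax p], [M = Z P] and [g = pg].  Since [t |-> t / (t + g)] is
    nondecreasing, [D*_max = M / (M + g)], so the integrand of [2 LG] is
    [g^2 (P + g) / (Z P + g)^2 = P phi (g / P)] with
    [phi t = t^2 (1 + t) / (Z + t)^2].  As [Z >= 1], [phi] lies above its tangent
    line at [t = 1], touching it only there, and the tangent line contributes the
    constant [phi 1 = 2 / (Z + 1)^2] because [P] and [g] have the same mass.  Hence
    [2 LG] is [phi 1] plus the integral of a nonnegative excess that vanishes
    exactly where [g = P]. *)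

Require Import Defs.
From mathcomp Require Import all_boot all_order all_algebra.
From mathcomp Require Import all_classical all_reals all_analysis.
From mathcomp Require Import measurable_realfun ring lra.

Import Order.TTheory GRing.Theory Num.Theory.

Local Open Scope ring_scope.

(* [P (phi t - phi 1 - phi' 1 (t - 1))] at [t = g / P], in factored form. *)
Definition excess {R : realType} (Z P g : R) : R :=
  (g - P) ^+ 2 * ((Z ^+ 3 + 3 * Z ^+ 2 - 2 * Z) * g + (3 * Z - 1) * Z ^+ 2 * P)
  * ((Z + 1) ^+ 3)^-1 * ((Z * P + g)^-1) ^+ 2.

Section Pointwise.
Context {R : realType}.
Implicit Types (Z P g : R).

(** Since [1 <= Z], the coefficients [Z (Z^2 + 3 Z - 2)] and [(3 Z - 1) Z^2] of the linear factor
    are positive. *)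
Lemma excess_ge0 Z P g : 1 <= Z -> 0 <= P -> 0 <= g -> 0 <= excess Z P g.
Proof.
move=> Z1 P0 g0; rewrite /excess.
apply: mulr_ge0; last exact: sqr_ge0.
apply: mulr_ge0; last by rewrite invr_ge0 exprn_ge0//; lra.
apply: mulr_ge0; first exact: sqr_ge0.
have Z0 : 0 <= Z by lra.
have A : 0 <= Z ^+ 3 + 3 * Z ^+ 2 - 2 * Z by nra.
by apply: addr_ge0; apply: mulr_ge0 => //; apply: mulr_ge0; rewrite ?sqr_ge0//; lra.
Qed.

Lemma excess_eq0 Z P g : 1 <= Z -> 0 <= P -> 0 <= g -> excess Z P g = 0 <-> g = P.
Proof.
move=> Z1 P0 g0; split; last by move=> ->; rewrite /excess subrr expr0n/= !mul0r.
have Z0 : 0 <= Z by lra.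
have A : 0 < Z ^+ 3 + 3 * Z ^+ 2 - 2 * Z by nra.
move=> /eqP; rewrite /excess !mulf_eq0 !(invr_eq0, expf_eq0)/=.
have -> : (Z + 1 == 0) = false by apply/negbTE; rewrite gt_eqF//; lra.
(* At [P = 0] every factor that can vanish, the inverted denominator included ([0^-1 = 0]), does so
   only when [g = 0]. For [P > 0] only [(g - P) ^+ 2] can vanish. *)
have [->|Pn0] := eqVneq P 0.
  rewrite !mulr0 !addr0 add0r subr0 mulf_eq0 (gt_eqF A) /=.
  by case: eqVneq.
have {Pn0}P1 : 0 < P by rewrite lt_def Pn0.
rewrite (@gt_eqF _ _ (Z * P + g) 0) ?ltr_wpDr ?mulr_gt0//; last lra.
rewrite (@gt_eqF _ _ (_ + _ * P) 0) ?ltr_wpDl ?mulr_gt0 ?mulr_ge0 ?(ltW A)//.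
1: by rewrite !orbF subr_eq0 orbb => /eqP.
all: lra.
Qed.

(* The subtracted terms of the tangent line are moved across so that both sides
   are sums of nonnegative functions, which can be integrated termwise. *)
Lemma excessE Z P g : 1 <= Z -> 0 <= P -> 0 <= g ->
  (Z * P / (Z * P + g) - 1) ^+ 2 * P + (Z * P / (Z * P + g) - 1) ^+ 2 * g
    + (5 * Z + 1) / (Z + 1) ^+ 3 * P =
  excess Z P g + 2 / (Z + 1) ^+ 2 * P + (5 * Z + 1) / (Z + 1) ^+ 3 * g.
Proof.
move=> Z1 P0 g0; rewrite /excess.
have Zn0 : Z + 1 != 0 by rewrite gt_eqF//; lra.
have [Mg|Mg] := eqVneq (Z * P + g) 0; last by field; apply/andP.
have [-> ->] : P = 0 /\ g = 0 by split; nra.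
by rewrite subrr expr0n/= !(mulr0, mul0r, addr0).
Qed.

Lemma ratio_le g (a b : R) : 0 <= g -> 0 <= a -> a <= b -> a / (a + g) <= b / (b + g).
Proof.
move=> g0 a0 ab; have [->|an0] := eqVneq a 0.
  by rewrite mul0r divr_ge0//; lra.
have {a0 an0}a0 : 0 < a by rewrite lt_def an0.
by rewrite ler_pdivrMr 1?mulrAC ?ler_pdivlMr; nra.
Qed.

End Pointwise.

(* [powR] is measurable, and [y `^ (-1) = y^-1] for [0 <= y], including at 0. *)
Lemma measurable_invr_ge0 {R : realType} {d} {T : measurableType d} (f : T -> R) :
  (forall x, 0 <= f x) -> measurable_fun setT f ->
  measurable_fun setT (fun x => (f x)^-1).
Proof.
move=> f0 mf; under eq_fun do rewrite -powR_inv1//.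
exact: (measurableT_comp (measurable_powR _)).
Qed.

Section Objective.
Context {R : realType} {d N : nat}.
Variables (p : 'I_N -> euclid R d -> R).
Hypotheses (N0 : (0 < N)%N) (hp : forall i, is_density (p i)).

Lemma Dstar_maxE (q : euclid R d -> R) x : 0 <= q x ->
  Dstar_max p q x = max_density p x / (max_density p x + q x).
Proof.
move=> q0; rewrite /Dstar_max /max_density.
suff [] : 0 <= \big[Num.max/0]_(i < N) p i x /\
    \big[Num.max/0]_(i < N) Dstar p q i x =
    \big[Num.max/0]_(i < N) p i x / (\big[Num.max/0]_(i < N) p i x + q x) by [].
(* The map [t |-> t / (t + q x)] sends the seed 0 to 0 and commutes with max by monotonicity;
   [0 <= b] is carried along because [ratio_le] needs it. *)
apply: (big_ind2 (fun b a => 0 <= b /\ a = b / (b + q x))).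
- by rewrite mul0r.
- move=> b a b' a' [b0 ->] [b0' ->]; have [bb|bb] := leP b b'.
    by rewrite max_r// ratio_le.
  by rewrite max_l// ratio_le// ltW.
- by move=> i _; case: (hp i).
Qed.

Lemma measurable_max_density : measurable_fun setT (max_density p).
Proof.
rewrite /max_density; elim: (index_enum 'I_N) => [|i s IH].
  under eq_fun do rewrite big_nil; exact: measurable_cst.
under eq_fun do rewrite big_cons.
by apply: measurable_maxr => //; case: (hp i).
Qed.

Lemma max_density_ge0 x : 0 <= max_density p x.
Proof. exact: bigmax_ge_id. Qed.

Lemma Zmax_ge1 : 1 <= Zmax p.
Proof.
have mM : measurable_fun setT (EFin \o max_density p).
  by apply/measurable_EFinP; exact: measurable_max_density.
have M0 x : (0 <= (max_density p x)%:E)%E by rewrite lee_fin max_density_ge0.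
pose I := (\int[lebesgue R d]_x (max_density p x)%:E)%E.
have I1 : (1 <= I)%E.
  have [mp p0 <-] := hp (Ordinal N0).
  apply: ge0_le_integral => //; first by move=> x _; rewrite lee_fin.
    exact/measurable_EFinP.
  by move=> x _; rewrite lee_fin; exact: le_bigmax.
have ZI : Zmax p = fine I by [].
have Z0 : 0 <= Zmax p by rewrite ZI fine_ge0// (le_trans _ I1).
(* It remains to exclude [I = +oo]: then [fine I = 0], so [pmax p] would be identically 0 and could
   not have integral 1. *)
have [_ _] := pmax_density N0 hp.
rewrite /pmax; under eq_integral do rewrite EFinM.
rewrite ge0_integralZl// ?lee_fin ?invr_ge0// -/I ZI.
case: (I) I1 => [r| |] /=; [by rewrite lee_fin| |by []].
by rewrite invr0 mul0e => _ /esym/eqP; rewrite onee_eq0.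
Qed.

Lemma max_densityE x : max_density p x = Zmax p * pmax p x.
Proof.
by rewrite /pmax mulrA mulfV ?mul1r// gt_eqF// (lt_le_trans _ Zmax_ge1).
Qed.

Lemma measurable_excess (q : euclid R d -> R) : is_density q ->
  measurable_fun setT (fun x => excess (Zmax p) (pmax p x) (q x)).
Proof.
have [mP P0 _] := pmax_density N0 hp => -[mq q0 _].
have Z0 : 0 <= Zmax p by rewrite (le_trans _ Zmax_ge1).
rewrite /excess; apply: measurable_funM.
  apply: measurable_funM => //; apply: measurable_funM.
    by apply: measurable_funX; exact: measurable_funB.
  by apply: measurable_funD; exact: measurable_funM.
apply: measurable_funX; apply: measurable_invr_ge0.
  by move=> x; rewrite addr_ge0// mulr_ge0.
by apply: measurable_funD => //; exact: measurable_funM.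
Qed.

Lemma LGE (q : euclid R d -> R) : is_density q ->
  LG p q = ((2^-1)%:E * (\int[lebesgue R d]_x (excess (Zmax p) (pmax p x) (q x))%:E
                         + (2 / (Zmax p + 1) ^+ 2)%:E))%E.
Proof.
move=> hq; have [mq q0 q1] := hq; have [mP P0 P1] := pmax_density N0 hp.
have Z1 := Zmax_ge1; have mE := measurable_excess _ hq.
set Z := Zmax p in Z1 mE *; set P := pmax p in mP P0 P1 mE *.
pose M x := Z * P x.
have M0 x : 0 <= M x by rewrite mulr_ge0//; lra.
have mM : measurable_fun setT M by exact: measurable_funM.
have mD : measurable_fun setT (fun x => (M x / (M x + q x) - 1) ^+ 2).
  apply: measurable_funX; apply: measurable_funB => //.
  apply: measurable_funM => //; apply: measurable_invr_ge0.
    by move=> x; rewrite addr_ge0.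
  exact: measurable_funD.
have DE x : Dstar_max p q x = M x / (M x + q x) by rewrite Dstar_maxE// max_densityE.
rewrite /LG /expectation_density -/P; congr (_ * _)%E.
under eq_integral do rewrite DE.
under [X in (_ + X)%E]eq_integral do rewrite DE.
(* These are the value [c = phi 1] and the slope [s = phi' 1] of the tangent line. *)
set c := 2 / (Z + 1) ^+ 2; set s := (5 * Z + 1) / (Z + 1) ^+ 3.
have c0 : 0 <= c by rewrite divr_ge0// exprn_ge0//; lra.
have s0 : 0 <= s by rewrite divr_ge0 ?exprn_ge0//; lra.
have int_scale (k : R) (f : euclid R d -> R) : is_density f -> 0 <= k ->
    (\int[lebesgue R d]_x (k * f x)%:E = k%:E)%E.
  move=> [mf f0 f1] k0; under eq_integral do rewrite EFinM.
  rewrite ge0_integralZl ?f1 ?mule1//; first exact/measurable_EFinP.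
  by move=> x _; rewrite lee_fin.
have intD (f g : euclid R d -> R) : measurable_fun setT f -> measurable_fun setT g ->
    (forall x, 0 <= f x) -> (forall x, 0 <= g x) ->
    (\int[lebesgue R d]_x (f x)%:E + \int[lebesgue R d]_x (g x)%:E =
     \int[lebesgue R d]_x (f x + g x)%:E)%E.
  move=> mf mg f0 g0; under [RHS]eq_integral do rewrite EFinD.
  rewrite ge0_integralD//; try by move=> x _; rewrite lee_fin.
    exact/measurable_EFinP.
  exact/measurable_EFinP.
have hP : is_density P by [].
have e0 x : 0 <= excess Z (P x) (q x) by rewrite excess_ge0.
(* The finite [s] is added to both sides, then written as the integral of [s P] on the left and of
   [s q] on the right. This is where the equal masses of [P] and [q] enter; [excessE] then matches
   the integrands pointwise. *)
rewrite -[LHS](@addeK _ s%:E)// -[RHS](@addeK _ s%:E)//; congr (_ - _)%E.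
rewrite -[in LHS](int_scale s P)// -(int_scale c P)// -(int_scale s q)//.
have mZl (k : R) (f : euclid R d -> R) : measurable_fun setT f ->
    measurable_fun setT (fun x => k * f x) by move=> ?; exact: measurable_funM.
have mMr (f : euclid R d -> R) : measurable_fun setT f ->
    measurable_fun setT (fun x => (M x / (M x + q x) - 1) ^+ 2 * f x).
  by move=> ?; exact: measurable_funM.
have Dq f x : 0 <= f x -> 0 <= (M x / (M x + q x) - 1) ^+ 2 * f x.
  by move=> ?; rewrite mulr_ge0 ?sqr_ge0.
rewrite !intD//; do ?[by move=> x; do ?[exact: e0|exact: Dq|exact: mulr_ge0|apply: addr_ge0]
  | by repeat (apply: measurable_funD; auto); auto].
by apply: eq_integral => x _; rewrite excessE.
Qed.

End Objective.

Theorem theorem2 (R : realType) (d N : nat)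
    (p : 'I_N -> euclid R d -> R) (pg : euclid R d -> R) :
  (0 < N)%N ->
  (forall i, is_density (p i)) ->
  is_density pg ->
  (forall q : euclid R d -> R, is_density q -> (LG p pg <= LG p q)%E) <->
  {ae lebesgue R d, forall x, pg x = pmax p x}.
Proof.
move=> N0 hp hpg; have Z1 := Zmax_ge1 _ N0 hp.
have [mP P0 P1] := pmax_density N0 hp; have [_ pg0 _] := hpg.
have e0 q x : is_density q -> (0 <= (excess (Zmax p) (pmax p x) (q x))%:E)%E.
  by case=> _ q0 _; rewrite lee_fin excess_ge0.
(* The additive constant in [LGE] is finite and independent of the density, so it cancels. *)
have LG_le q : is_density q -> (LG p pg <= LG p q)%E =
    (\int[lebesgue R d]_x (excess (Zmax p) (pmax p x) (pg x))%:E <=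
     \int[lebesgue R d]_x (excess (Zmax p) (pmax p x) (q x))%:E)%E.
  by move=> hq; rewrite !LGE// lee_pmul2l ?lte_fin ?invr_gt0// leeD2rE.
have int0 : (\int[lebesgue R d]_x (excess (Zmax p) (pmax p x) (pg x))%:E = 0)%E <->
    {ae lebesgue R d, forall x, pg x = pmax p x}.
  have := ae_eq_integral_abs (lebesgue R d) measurableT
    (proj2 (measurable_EFinP _ _) (measurable_excess _ N0 hp _ hpg)).
  under eq_integral do rewrite gee0_abs ?e0//.
  move=> ->; split; apply: filterS => x.
    by move=> /(_ I)/= [] /(excess_eq0 _ _ _ Z1 (P0 x) (pg0 x)).
  by move=> pgx _ /=; congr EFin; apply/excess_eq0.
split=> [min|/int0 pg_int0 q hq].
  apply/int0/eqP; rewrite eq_le integral_ge0 ?andbT; last by move=> x _; exact: e0.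
  (* The competitor is [pmax p] itself, whose excess is identically 0. *)
  have := min _ (pmax_density N0 hp); rewrite LG_le; last exact: pmax_density.
  rewrite [X in (_ <= X)%E]integral0_eq// => x _; congr EFin.
  exact/excess_eq0.
by rewrite LG_le// pg_int0; apply: integral_ge0 => x _; exact: e0.
Qed.
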